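(* Let $\nu>0$, $\lambda>0$, $\eta\in\mathbb{R}\setminus\{0\}$, $m\ge 1$, and let $F(V,t)=\nu V$ ($V\in\mathbb{R}$, $t>0$), $h(x)=\eta x^m$ and $\Phi(x)=\lambda x$ ($x>0$). Then the heat flux at the boundary $x=0$ corresponding to the solution $u$ to Problem P given by the integral representation described in the context is $$u_x(0,t)=\begin{cases}\eta\exp(-\nu\lambda t) & \text{if }m=1,\\[2pt] \dfrac{c(m-1)}{2}\exp(-\nu\lambda t)\displaystyle\int_0^t\tau^{(m-3)/2}\exp(\nu\lambda\tau)\,d\tau & \text{if }m>1,\end{cases}\qquad t>0,$$ where $c=\dfrac{2^{m-1}m\eta}{\sqrt{\pi}}\,\Gamma\!\left(\dfrac m2\right)$ and $\Gamma$ is the Gamma function.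
   Context: Problem P: $u_t(x,t)-u_{xx}(x,t)=-\Phi(x)F(u_x(0,t),t)$ for $x>0,t>0$; $u(x,0)=h(x)$ for $x>0$; $u(0,t)=0$ for $t>0$. For $F(V,t)=\nu V$, the solution $u$ considered is $$u(x,t)=\int_0^{+\infty}G(x,t,\xi,0)h(\xi)\,d\xi-\nu\int_0^t\Big(\int_0^{+\infty}G(x,t,\xi,\tau)\Phi(\xi)\,d\xi\Big)V(\tau)\,d\tau,\quad x\ge0,\ t\ge 0,$$ where $G(x,t,\xi,\tau)=K(x,t,\xi,\tau)-K(-x,t,\xi,\tau)$, $K(x,t,\xi,\tau)=\frac{1}{2\sqrt{\pi(t-\tau)}}\exp\big(-(x-\xi)^2/(4(t-\tau))\big)$, and $V(t)=u_x(0,t)$ satisfies the Volterra integral equation $$V(t)=V_0(t)-\nu\int_0^tR(t-\tau)V(\tau)\,d\tau,\quad t>0,$$ with $V_0(t)=\frac{1}{\sqrt{\pi t}}\int_0^{+\infty}\exp(-\xi^2/4t)h'(\xi)\,d\xi$ and $R(t)=\frac{1}{2\sqrt{\pi}\,t^{3/2}}\int_0^{+\infty}\xi\exp(-\xi^2/4t)\Phi(\xi)\,d\xi$. *)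

(* Defs.v *)
From HB Require Import structures.
From mathcomp Require Import all_boot all_order all_algebra.
From mathcomp Require Import all_classical all_reals all_analysis.
Set Implicit Arguments.
Unset Strict Implicit.
Unset Printing Implicit Defensive.
Import Order.TTheory GRing.Theory Num.Theory.
Import numFieldNormedType.Exports.
Local Open Scope classical_set_scope.
Local Open Scope ring_scope.

Section Defs.
Context {R : realType}.
Local Notation mu := (@lebesgue_measure R).

(* Euler's Gamma function, for a > 0. *)
Definition Gamma (a : R) : R :=
  \int[mu]_(s in `]0, +oo[) (s `^ (a - 1) * expR (- s)).

(* Difference quotient whose limit at 0 from the right is u_x(0, t); it is
   one-sided because the spatial domain is x >= 0. *)
Definition flux_quotient (u : R -> R -> R) (t x : R) : R :=
  x^-1 * (u x t - u 0 t).

Definition boundary_flux (u : R -> R -> R) (t : R) : R :=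
  lim (flux_quotient u t x @[x --> 0^'+]).

(* u_t - u_xx = - Phi(x) F(u_x(0,t), t), u(x,0) = h(x), u(0,t) = 0.  The
   functions of x are only constrained on x > 0. *)
Record solves_problemP (F : R -> R -> R) (h Phi : R -> R)
    (u : R -> R -> R) : Prop := SolvesProblemP {
  problemP_derivable_t : forall x t, 0 < x -> 0 < t -> derivable (u x) t 1 ;
  problemP_derivable_x : forall x t, 0 < x -> 0 < t ->
    derivable (u ^~ t) x 1 ;
  problemP_derivable_xx : forall x t, 0 < x -> 0 < t ->
    derivable (derive1 (u ^~ t)) x 1 ;
  problemP_pde : forall x t, 0 < x -> 0 < t ->
    derive1 (u x) t - derive1n 2 (u ^~ t) x = - Phi x * F (boundary_flux u t) t ;
  problemP_initial : forall x, 0 < x -> u x 0 = h x ;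
  problemP_boundary : forall t, 0 < t -> u 0 t = 0 }.

Definition heat_kernel (x t xi tau : R) : R :=
  (2 * Num.sqrt (pi * (t - tau)))^-1
  * expR (- (x - xi) ^+ 2 / (4 * (t - tau))).

Definition green (x t xi tau : R) : R :=
  heat_kernel x t xi tau - heat_kernel (- x) t xi tau.

Definition volterra_source (h : R -> R) (t : R) : R :=
  (Num.sqrt (pi * t))^-1
  * \int[mu]_(xi in `]0, +oo[) (expR (- xi ^+ 2 / (4 * t)) * derive1 h xi).

Definition volterra_kernel (Phi : R -> R) (t : R) : R :=
  (2 * Num.sqrt pi * t `^ (3 / 2))^-1
  * \int[mu]_(xi in `]0, +oo[) (xi * expR (- xi ^+ 2 / (4 * t)) * Phi xi).

(* The integral being total, its convergence has to be required separately. *)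
Definition solves_volterra (nu : R) (h Phi V : R -> R) : Prop :=
  forall t, 0 < t ->
    mu.-integrable `]0, t[
      (EFin \o (fun tau => volterra_kernel Phi (t - tau) * V tau)) /\
    V t = volterra_source h t
          - nu * \int[mu]_(tau in `]0, t[)
                   (volterra_kernel Phi (t - tau) * V tau).

(* At t = 0 the Green function is singular and the right-hand side only makes
   sense as a limit, so the formula is imposed for t > 0; the value of u at
   t = 0 is given by the initial condition. *)
Definition integral_representation (nu : R) (h Phi V : R -> R)
    (u : R -> R -> R) : Prop :=
  forall x t, 0 <= x -> 0 < t ->
    u x t = \int[mu]_(xi in `]0, +oo[) (green x t xi 0 * h xi)
            - nu * \int[mu]_(tau in `]0, t[)
                     ((\int[mu]_(xi in `]0, +oo[)
                         (green x t xi tau * Phi xi)) * V tau).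

End Defs.

(* Main.v *)
Require Import Defs.
From HB Require Import structures.
From mathcomp Require Import all_boot all_order all_algebra.
From mathcomp Require Import all_classical all_reals all_analysis.
From mathcomp Require Import measurable_realfun ring lra.
Import Order.TTheory GRing.Theory Num.Theory.
Import numFieldNormedType.Exports.
Local Open Scope classical_set_scope.
Local Open Scope ring_scope.

(**
For [Phi x = lambda x] the Volterra kernel is the constant [lambda], and for
[h x = eta x^m] the source is a multiple of [t^((m-1)/2)]; both reduce to moments
of a Gaussian on the half-line, the second one being a value of [Gamma] through
the substitution [y = z^2 / s].  As the Green function maps [xi] to [x], the flux
quotient of [u] at [x] equals the one of the heat transform of [h] minus
[nu lambda \int_0^t V].  By differentiation under the integral sign the former
tends to the source of the Volterra equation, so that [u_x(0, t) = V t].  Finally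
[psi t := exp (nu lambda t) V t] satisfies
[psi' t = c (m - 1) / 2 t^((m-3)/2) exp (nu lambda t)], and is recovered from its
value at [0+].
*)

(** * Improper integrals *)

(** Dominated convergence for the restrictions of [f] to the [A n], with [abse \o f] as majorant: an
    exhaustion argument for integrands of arbitrary sign. *)
Lemma nondecreasing_bigcup_cvg_integral (d : measure_display)
    (T : measurableType d) (R : realType) (mu : {measure set T -> \bar R})
    (A : nat -> set T) (f : T -> \bar R) :
  {homo A : n m / (n <= m)%N >-> n `<=` m} -> (forall n, measurable (A n)) ->
  mu.-integrable (\bigcup_n A n) f ->
  (\int[mu]_(x in A n) f x)%E @[n --> \oo] -->
  (\int[mu]_(x in \bigcup_n A n) f x)%E.
Proof.
move=> ndA mA intf; set D := \bigcup_n A n.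
have mD : measurable D by exact: bigcup_measurable.
have AD n : A n `<=` D by move=> x Ax; exists n.
have mf := measurable_int _ intf.
under eq_fun => n do rewrite -(setIidr (AD n)) integral_mkcondr.
have [] // := @dominated_convergence _ _ _ mu D mD (fun n => f \_ (A n)) f
  (abse \o f).
- move=> n; apply/measurable_restrict => //.
  by apply: measurable_funS mf => // x [].
- apply: aeW => x [n _ Anx]; apply: cvg_near_cst.
  near=> m; rewrite patchE mem_set//; apply: ndA Anx.
  by near: m; exists n.
- exact: integrable_abse.
- apply: aeW => x n Dx; rewrite patchE.
  (* Outside [A n] the restriction takes the default value [point], which is 0 in the extended
     reals. *)
  by case: ifPn => // _; rewrite (_ : point = 0%E)// abse0; exact: abse_ge0.
Unshelve. all: end_near. Qed.

Section FTC2.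
Context {R : realType}.
Local Notation mu := (@lebesgue_measure R).
Implicit Types (f F : R -> R) (a b l x : R).

Lemma FTC2_segment f F a b : a < b ->
  (forall x, a <= x <= b -> {for x, continuous f}) ->
  (forall x, a <= x <= b -> is_derive x 1 F (f x)) ->
  (\int[mu]_(x in `[a, b]) (f x)%:E = (F b - F a)%:E)%E.
Proof.
move=> ab cf dF.
have cF x : a <= x <= b -> {for x, continuous F}.
  move=> xab; apply: differentiable_continuous; apply/derivable1_diffP.
  by have [] := dF x xab.
rewrite (@continuous_FTC2 _ f F)//.
- apply/continuous_within_itvP => //; split.
  + by move=> x; rewrite in_itv/= => /andP[/ltW ax /ltW xb]; apply: cf; rewrite ax.
  + by apply: cvg_at_right_filter; apply: cf; rewrite lexx ltW.
  + by apply: cvg_at_left_filter; apply: cf; rewrite lexx ltW.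
- split.
  + move=> x; rewrite in_itv/= => /andP[/ltW ax /ltW xb].
    by have [] : is_derive x 1 F (f x) by apply: dF; rewrite ax.
  + by apply: cvg_at_right_filter; apply: cF; rewrite lexx ltW.
  + by apply: cvg_at_left_filter; apply: cF; rewrite lexx ltW.
- move=> x; rewrite in_itv/= => /andP[/ltW ax /ltW xb].
  by rewrite derive1E; apply: derive_val; apply: dF; rewrite ax.
Qed.

Lemma nondecreasing_segments (x_ y_ : nat -> R) :
  {homo x_ : n m / (n <= m)%N >-> m <= n} ->
  {homo y_ : n m / (n <= m)%N >-> n <= m} ->
  {homo (fun n => `[x_ n, y_ n]%classic) : n m / (n <= m)%N >-> n `<=` m}.
Proof.
move=> nix ndy n m nm z /=; rewrite !in_itv/= => /andP[xz zy].
by rewrite (le_trans (nix _ _ nm))//= (le_trans zy)// ndy.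
Qed.

Section improper.
Variables (D : set R) (x_ y_ : nat -> R) (f F : R -> R) (l0 l : R).
Hypotheses (xy : forall n, x_ n < y_ n).
Hypotheses (nix : {homo x_ : n m / (n <= m)%N >-> m <= n}).
Hypotheses (ndy : {homo y_ : n m / (n <= m)%N >-> n <= m}).
Hypothesis DE : D = \bigcup_n `[x_ n, y_ n]%classic.
Hypothesis cf : forall x, D x -> {for x, continuous f}.
Hypothesis dF : forall x, D x -> is_derive x 1 F (f x).
Hypothesis Fl0 : F (x_ n) @[n --> \oo] --> l0.
Hypothesis Fl : F (y_ n) @[n --> \oo] --> l.

Let cvg_segment_integral :
  (\int[mu]_(x in `[x_ n, y_ n]) (f x)%:E)%E @[n --> \oo] --> (l - l0)%:E.
Proof.
have D_ n x : x_ n <= x <= y_ n -> D x.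
  by move=> xn; rewrite DE; exists n => //=; rewrite in_itv.
under eq_fun => n do rewrite (FTC2_segment f F _ _ (xy n)
  (fun x xn => cf x (D_ n x xn)) (fun x xn => dF x (D_ n x xn))).
by apply: cvg_EFin; [exact: nearW|exact: cvgB].
Qed.

Lemma ge0_improper_FTC2 : measurable_fun D f -> (forall x, D x -> 0 <= f x) ->
  (\int[mu]_(x in D) (f x)%:E = (l - l0)%:E)%E.
Proof.
move=> mf f0.
apply: (@cvg_unique _ _ _ _ _ _ _ cvg_segment_integral) => //.
rewrite DE; apply: ge0_nondecreasing_set_cvg_integral => //.
- by move=> n m nm; rewrite subsetEset; exact: nondecreasing_segments nm.
- move=> n; apply/measurable_EFinP; apply: measurable_funS mf => //.
    by rewrite DE; exact: bigcup_measurable.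
  by rewrite DE => x; exists n.
- by move=> n x nx; rewrite lee_fin f0// DE; exists n.
Qed.

(** For integrands of any sign, dominated convergence takes the place of monotone convergence. *)
Lemma improper_FTC2 : mu.-integrable D (EFin \o f) ->
  \int[mu]_(x in D) f x = l - l0.
Proof.
rewrite DE => intf; rewrite /Rintegral.
suff -> : (\int[mu]_(x in \bigcup_n [set` `[x_ n, y_ n]]) (f x)%:E = (l - l0)%:E)%E by [].
apply: (@cvg_unique _ _ _ _ _ _ _ cvg_segment_integral) => //.
have := @nondecreasing_bigcup_cvg_integral _ _ R mu
  (fun n => [set` `[x_ n, y_ n]]) (EFin \o f); apply => //.
by move=> n m nm; exact: (nondecreasing_segments x_ y_ nix ndy).
Qed.

End improper.

(** The right end is [n.+2] and not [n.+1], so that the segment of index 0 is not reduced to a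
    point. *)
Lemma itv0y_segments : `]0, +oo[%classic =
  \bigcup_n `[n.+1%:R^-1, n.+2%:R]%classic :> set R.
Proof.
apply/seteqP; split => x /=; rewrite in_itv/= andbT; last first.
  by move=> [n _]/=; rewrite in_itv/= => /andP[+ _]; apply: lt_le_trans.
move=> x0; have [N _ HN] := (nbhs_infty_gtr x).
have [M _ HM] := (nbhs_infty_gtr x^-1).
(* [N] bounds [x] and [M] bounds its inverse; the sum of the two serves both ends. *)
exists (N + M)%N => //=; rewrite in_itv/=; apply/andP; split.
  rewrite -(invrK x) lef_pV2 ?posrE ?invr_gt0//.
  apply: (le_trans (ltW (HM M (leqnn _)))).
  by rewrite ler_nat; apply: leq_trans (leqnSn _); exact: leq_addl.
apply: (le_trans (ltW (HN N (leqnn _)))).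
by rewrite ler_nat -addnS -addnS leq_addr.
Qed.

Lemma itv0c_segments b : 0 < b -> `]0, b]%classic =
  \bigcup_n `[b / n.+2%:R, b]%classic :> set R.
Proof.
move=> b0; apply/seteqP; split => x /=; rewrite in_itv/=; last first.
  move=> [n _]/=; rewrite in_itv/= => /andP[+ ->]; rewrite andbT.
  by apply: lt_le_trans; rewrite divr_gt0.
move=> /andP[x0 xb]; have [N _ HN] := (nbhs_infty_gtr (b / x)).
exists N => //=; rewrite in_itv/= xb andbT ler_pdivrMr// mulrC -ler_pdivrMr//.
apply: (le_trans (ltW (HN N (leqnn _)))).
by rewrite ler_nat -addn2 leq_addr.
Qed.

Lemma cvg_at_right_invn F l : F x @[x --> 0^'+] --> l ->
  F n.+1%:R^-1 @[n --> \oo] --> l.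
Proof.
by move/cvg_at_rightP; apply; split => [n|]; [rewrite invr_gt0|exact: cvg_harmonic].
Qed.

Lemma cvg_at_right_divn F l b : 0 < b -> F x @[x --> 0^'+] --> l ->
  F (b / n.+2%:R) @[n --> \oo] --> l.
Proof.
move=> b0 /cvg_at_rightP; apply; split => [n|]; first by rewrite divr_gt0.
rewrite -(mulr0 b); apply: cvgMl_tmp.
by have := @cvg_harmonic R; rewrite -cvg_shiftS.
Qed.

Lemma cvg_pinfty_natr F l : F x @[x --> +oo] --> l ->
  F n.+2%:R @[n --> \oo] --> l.
Proof.
move/cvg_pinftyP; apply.
by have := @cvgr_idn R; rewrite -cvg_shiftS -cvg_shiftS.
Qed.

Lemma invn_lt_natr n : n.+1%:R^-1 < n.+2%:R :> R.
Proof.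
apply: (@le_lt_trans _ _ 1); last by rewrite ltr1n.
by rewrite invf_le1// ler1n.
Qed.

Lemma nonincreasing_invn :
  {homo (fun n => n.+1%:R^-1 : R) : n m / (n <= m)%N >-> m <= n}.
Proof. by move=> n m nm; rewrite lef_pV2 ?posrE// ler_nat. Qed.

Lemma improper_FTC2_0y f F l0 l :
  (forall x, 0 < x -> {for x, continuous f}) ->
  (forall x, 0 < x -> is_derive x 1 F (f x)) ->
  F x @[x --> 0^'+] --> l0 -> F x @[x --> +oo] --> l ->
  mu.-integrable `]0, +oo[ (EFin \o f) ->
  \int[mu]_(x in `]0, +oo[) f x = l - l0.
Proof.
move=> cf dF Fl0 Fl intf.
apply: (@improper_FTC2 _ (fun n => n.+1%:R^-1) (fun n => n.+2%:R) f F) => //.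
- exact: invn_lt_natr.
- exact: nonincreasing_invn.
- by move=> n m nm; rewrite ler_nat.
- exact: itv0y_segments.
- by move=> x /=; rewrite in_itv/= andbT => /cf.
- by move=> x /=; rewrite in_itv/= andbT => /dF.
- exact: cvg_at_right_invn.
- exact: cvg_pinfty_natr.
Qed.

(** The segments shrink at 0 only, [F] being regular at [b]. The integrand may thus blow up at 0, as
    [x^(a-1)] does for [0 < a < 1]. *)
Lemma ge0_improper_FTC2_0c f F l0 b : 0 < b ->
  (forall x, 0 < x -> {for x, continuous f}) ->
  (forall x, 0 < x -> 0 <= f x) ->
  (forall x, 0 < x -> is_derive x 1 F (f x)) ->
  F x @[x --> 0^'+] --> l0 ->
  \int[mu]_(x in `]0, b[) f x = F b - l0.
Proof.
move=> b0 cf f0 dF Fl0.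
have mf : measurable_fun `]0%R : R, +oo[ f.
  apply: open_continuous_measurable_fun => // x.
  by rewrite inE/= in_itv/= andbT => /cf.
(* Adding the null point [b] makes the interval a union of segments. *)
rewrite /Rintegral integral_itv_bndo_bndc; last first.
  apply/measurable_EFinP; apply: measurable_funS mf => // x /=.
  by rewrite !in_itv/= andbT => /andP[].
have -> // : (\int[mu]_(x in `]0%R, b]) (f x)%:E = (F b - l0)%:E)%E.
apply: (@ge0_improper_FTC2 _ (fun n => b / n.+2%:R) (fun=> b) f F) => //.
- by move=> n; rewrite ltr_pdivrMr// ltr_pMr// ltr1n.
- by move=> n m nm; rewrite ler_pM2l// lef_pV2 ?posrE// ler_nat.
- exact: itv0c_segments.
- by move=> x /=; rewrite in_itv/= => /andP[/cf].
- by move=> x /=; rewrite in_itv/= => /andP[/dF].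
- exact: cvg_at_right_divn.
- exact: cvg_cst.
- apply: measurable_funS mf => // x /=.
  by rewrite !in_itv/= andbT => /andP[].
- by move=> x /=; rewrite in_itv/= => /andP[/f0].
Qed.

End FTC2.

(** * Gaussian integrals *)

Lemma integrable_scale (d : measure_display) (T : measurableType d)
    (R : realType) (mu : {measure set T -> \bar R}) (D : set T) (k : R)
    (f : T -> R) : measurable D ->
  mu.-integrable D (EFin \o f) -> mu.-integrable D (EFin \o (fun x => k * f x)).
Proof.
move=> mD intf.
by rewrite (_ : _ \o _ = fun x => k%:E * (f x)%:E)%E//; exact: integrableZl.
Qed.

(** With [s = 4 (t - tau)] this is the heat kernel without its normalising factor. *)
Definition gauss {R : realType} (s z : R) : R := expR (- z ^+ 2 / s).

Section gauss.
Context {R : realType}.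
Local Notation mu := (@lebesgue_measure R).
Implicit Types (s x y z p : R).

Lemma gauss_ge0 s z : 0 <= gauss s z.
Proof. exact: expR_ge0. Qed.

Lemma gaussN s z : gauss s (- z) = gauss s z.
Proof. by rewrite /gauss sqrrN. Qed.

Lemma gaussB s x y : gauss s (x - y) = gauss s (y - x).
Proof. by rewrite -gaussN opprB. Qed.

Lemma is_derive_gauss s z :
  is_derive z 1 (gauss s) (- (2 * z / s) * gauss s z).
Proof.
have dq : is_derive z 1 (fun z : R => - z ^+ 2 / s) (- (2 * z / s)).
  rewrite (_ : (fun _ => _) = (fun z : R => - s^-1 *: z ^+ 2)); last first.
    by apply/funext => y; rewrite /GRing.scale/=; ring.
  by apply: is_derive_eq; rewrite /GRing.scale/=; ring.
by rewrite mulrC; exact: (is_derive1_comp (is_derive_expR _) dq).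
Qed.

Lemma is_derive_gaussBl s x z :
  is_derive z 1 (fun z => gauss s (z - x)) (- (2 * (z - x) / s) * gauss s (z - x)).
Proof.
have dB : is_derive z 1 (fun z : R => z - x) 1.
  by apply: is_derive_eq; rewrite subr0.
by have := @is_derive1_comp _ _ _ z _ _ (is_derive_gauss s (z - x)) dB; rewrite mulr1.
Qed.

Lemma continuous_gauss s : continuous (gauss s).
Proof.
move=> z; apply: differentiable_continuous; apply/derivable1_diffP.
by have [] := is_derive_gauss s z.
Qed.

Lemma continuous_gaussBl s x : continuous (fun z => gauss s (z - x)).
Proof.
move=> z; apply: differentiable_continuous; apply/derivable1_diffP.
by have [] := is_derive_gaussBl s x z.
Qed.

(** Up to the factor [normal_peak sigma], this is the normal density of mean [x] and variance
    [s / 2], whose total mass is 1. *)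
Lemma integral_gaussB s x : 0 < s ->
  (\int[mu]_y (gauss s (y - x))%:E = (Num.sqrt (pi * s))%:E)%E.
Proof.
move=> s0; pose sigma := Num.sqrt (s / 2).
have sigma2 : sigma ^+ 2 *+ 2 = s.
  by rewrite sqr_sqrtr ?divr_ge0 ?ltW// -mulr_natr divfK.
have sigma0 : sigma != 0 by rewrite gt_eqF// sqrtr_gt0 divr_gt0.
have peakE : (normal_peak sigma)^-1 = Num.sqrt (pi * s).
  by rewrite /normal_peak invrK -mulrnAl sigma2 mulrC.
have peak0 : 0 < normal_peak sigma by exact: normal_peak_gt0.
rewrite -peakE.
transitivity (\int[mu]_y ((normal_peak sigma)^-1%:E * (normal_pdf x sigma y)%:E))%E.
  apply: eq_integral => y _; rewrite normal_pdfE// -EFinM mulKf ?gt_eqF//.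
  by rewrite /normal_fun sigma2.
rewrite integralZl//; last exact: integrable_normal_pdf.
by rewrite integral_normal_pdf mule1.
Qed.

Lemma integrable_gaussB s x : 0 < s ->
  mu.-integrable setT (fun y => (gauss s (y - x))%:E).
Proof.
move=> s0; apply/integrableP; split.
  by apply/measurable_EFinP; apply: continuous_measurable_fun; exact: continuous_gaussBl.
under eq_integral do rewrite gee0_abs ?lee_fin ?gauss_ge0//.
by rewrite integral_gaussB// ltry.
Qed.

(** The integrand is even in [y], so the integral is half of the one over the line, where each term
    contributes [sqrt (pi s)]. *)
Lemma Rintegral_gauss_pair s x : 0 < s ->
  \int[mu]_(y in `]0, +oo[) (gauss s (y - x) + gauss s (y + x)) = Num.sqrt (pi * s).
Proof.
move=> s0; pose f y := gauss s (y - x) + gauss s (y + x).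
have fE y : f y = gauss s (y - x) + gauss s (y - (- x)) by rewrite opprK.
have f0 y : 0 <= f y by rewrite addr_ge0// gauss_ge0.
have cf : continuous f.
  move=> y; rewrite (_ : f = fun y => gauss s (y - x) + gauss s (y - (- x))).
    by apply: cvgD; exact: continuous_gaussBl.
  by apply/funext => z.
have := @ge0_symfun_integralT R f f0 cf.
have -> : [set y : R | 0 <= y] = `[0, +oo[%classic.
  by apply/seteqP; split => y/=; rewrite in_itv/= andbT.
rewrite -integral_itv_obnd_cbnd; last first.
  by apply/measurable_EFinP/measurable_funTS; exact: continuous_measurable_fun.
move=> /(_ _)/wrap[].
  move=> y /=; rewrite /f addrC; congr (_ + _).
    by rewrite -gaussN opprD.
  by rewrite -gaussN opprD opprK.
under eq_integral do rewrite fE EFinD.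
rewrite integralD//; [|exact: integrable_gaussB..].
rewrite !integral_gaussB// /Rintegral -EFinD.
(* The symmetry identity lives in the extended reals; an infinite half-line integral would
   contradict the finite total. *)
case: (\int[mu]_(y in `]0%R, +oo[) (f y)%:E)%E => [r| |]//=.
- by rewrite -EFinM => -[]/=; lra.
- by rewrite mulry gtr0_sg// mul1e.
- by rewrite mulrNy gtr0_sg// mul1e.
Qed.

End gauss.

(** * Moments of shifted Gaussians on the half-line *)

Section powR_gauss.
Context {R : realType}.
Local Notation mu := (@lebesgue_measure R).
Implicit Types (s x y z p : R).

(** From [ln y <= y] one gets [y^p <= exp (p y)], and completing squares absorbs both this factor
    and the shift [x] into a wider centred Gaussian. This majorant yields integrability as well as
    decay at infinity. *)
Lemma gauss_powR_le s p x y : 0 < s -> 0 <= p -> 0 < y ->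
  y `^ p * gauss s (y - x) <=
  expR (p ^+ 2 * s + x ^+ 2 / s) * gauss (4 * s) y.
Proof.
move=> s0 p0 y0; rewrite /powR gt_eqF// /gauss -!expRD ler_expR.
have lny : p * ln y <= p * y by rewrite ler_wpM2l// ltW// ln_sublinear.
apply: (le_trans (lerD lny (lexx _))); rewrite -subr_ge0.
have -> : p ^+ 2 * s + x ^+ 2 / s + - y ^+ 2 / (4 * s) -
    (p * y + - (y - x) ^+ 2 / s) =
  ((2 * p * s - y) ^+ 2 + 2 * (y - 2 * x) ^+ 2) / (4 * s).
  by field; rewrite gt_eqF.
by rewrite divr_ge0 ?mulr_ge0 ?(ltW s0)// addr_ge0 ?sqr_ge0// mulr_ge0 ?sqr_ge0.
Qed.

Lemma continuous_powR_gauss s p x z : 0 < z ->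
  {for z, continuous (fun y => y `^ p * gauss s (y - x))}.
Proof.
move=> z0; apply: continuousM; last exact: continuous_gaussBl.
apply: differentiable_continuous; apply/derivable1_diffP.
by have [] := is_derive1_powR p z0.
Qed.

Lemma measurable_powR_gauss s p x (D : set R) :
  measurable_fun D (fun y => y `^ p * gauss s (y - x)).
Proof.
apply: measurable_funTS; apply: measurable_funM; first exact: measurable_powR.
by apply: continuous_measurable_fun; exact: continuous_gaussBl.
Qed.

Lemma integrable_powR_gaussB s p x : 0 < s -> 0 <= p ->
  mu.-integrable `]0, +oo[ (EFin \o (fun y => y `^ p * gauss s (y - x))).
Proof.
move=> s0 p0; set C := expR (p ^+ 2 * s + x ^+ 2 / s).
apply: (@le_integrable _ _ _ mu _ _ _ (fun y => C%:E * (gauss (4 * s) (y - 0))%:E)%E) => //.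
- by apply/measurable_EFinP; exact: measurable_powR_gauss.
- move=> y /=; rewrite in_itv/= andbT => y0; rewrite subr0.
  rewrite lee_fin !ger0_norm ?mulr_ge0 ?powR_ge0 ?gauss_ge0 ?expR_ge0//.
  exact: gauss_powR_le.
- apply: integrableZl => //; apply: (@integrableS _ _ _ mu setT) => //.
  by apply: integrable_gaussB; rewrite mulr_gt0.
Qed.

Lemma integrable_powR_gauss s p : 0 < s -> 0 <= p ->
  mu.-integrable `]0, +oo[ (EFin \o (fun y => y `^ p * gauss s y)).
Proof.
move=> s0 p0; have := integrable_powR_gaussB s p 0 s0 p0.
by apply: eq_integrable => // y _ /=; rewrite subr0.
Qed.

Lemma cvgy_powR_gauss s p x : 0 < s -> 0 <= p ->
  y `^ p * gauss s (y - x) @[y --> +oo] --> 0.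
Proof.
move=> s0 p0; set C := expR (p ^+ 2 * s + x ^+ 2 / s).
apply: (@squeeze_cvgr _ _ _ _ (fun=> 0) (fun y => C * gauss (4 * s) y)).
- near=> y; rewrite mulr_ge0 ?powR_ge0 ?gauss_ge0//=.
  by apply: gauss_powR_le => //; near: y; exact: nbhs_pinfty_gt.
- exact: cvg_cst.
- rewrite -(mulr0 C); apply: cvgMl_tmp.
  rewrite /gauss.
  under eq_fun do rewrite mulNr.
  apply: (cvg_comp (fun y => y ^+ 2 / (4 * s)) (fun y => expR (- y))).
    by apply: gt0_cvgMly; [rewrite invr_gt0 mulr_gt0|exact: cvgr_expr2].
  exact: cvgr_expR.
Unshelve. all: end_near. Qed.

Lemma Rintegral_gauss s : 0 < s ->
  \int[mu]_(y in `]0, +oo[) gauss s y = Num.sqrt (pi * s) / 2.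
Proof.
move=> s0; rewrite -(Rintegral_gauss_pair s 0 s0).
have i0 : mu.-integrable `]0%R, +oo[ (EFin \o gauss s).
  have := integrable_powR_gauss s 0 s0 (lexx _).
  by apply: eq_integrable => // y _ /=; rewrite powRr0 mul1r.
under [in RHS]eq_Rintegral do rewrite subr0 addr0.
by rewrite RintegralD//; lra.
Qed.

(** Integration by parts: [y^(p+1) gauss s y] vanishes at 0 and at infinity, so its derivative, a
    combination of the two moments, has integral 0. *)
Lemma Rintegral_powR_gauss_rec s p : 0 < s -> 0 <= p ->
  \int[mu]_(y in `]0, +oo[) (y `^ (p + 2) * gauss s y) =
  (p + 1) * s / 2 * \int[mu]_(y in `]0, +oo[) (y `^ p * gauss s y).
Proof.
move=> s0 p0.
have p20 : 0 <= p + 2 by rewrite addr_ge0.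
have p10 : 0 < p + 1 by rewrite ltr_wpDl.
have ip := integrable_powR_gauss s p s0 p0.
have ip2 := integrable_powR_gauss s (p + 2) s0 p20.
have ikp k := integrable_scale _ _ _ mu _ k _ (measurable_itv _) ip.
have ikp2 k := integrable_scale _ _ _ mu _ k _ (measurable_itv _) ip2.
have : \int[mu]_(y in `]0, +oo[) ((p + 1) * (y `^ p * gauss s y)
    - 2 / s * (y `^ (p + 2) * gauss s y)) = 0 - 0.
  apply: (@improper_FTC2_0y _ _ (fun y => y `^ (p + 1) * gauss s y)).
  - move=> z z0.
    have cq q : {for z, continuous (fun y => y `^ q * gauss s y)}.
      rewrite (_ : (fun _ => _) = fun y => y `^ q * gauss s (y - 0)).
        exact: continuous_powR_gauss.
      by apply/funext => y; rewrite subr0.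
    by apply: continuousB; apply: continuousM => //; exact: cst_continuous.
  - move=> z z0; have dp := is_derive1_powR (p + 1) z0.
    have dg := is_derive_gauss s z.
    have -> : (p + 1) * (z `^ p * gauss s z) - 2 / s * (z `^ (p + 2) * gauss s z)
      = z `^ (p + 1) *: (- (2 * z / s) * gauss s z) +
        gauss s z *: ((p + 1) * z `^ (p + 1 - 1)).
      have -> : z `^ (p + 2) = z `^ (p + 1) * z.
        rewrite -[X in _ * X]powRr1 ?ltW// -powRD; first by congr powR; ring.
        by rewrite (gt_eqF z0) implybT.
      rewrite addrK /GRing.scale/=.
      ring.
    exact: is_deriveM.
  - rewrite -[X in _ --> X](mul0r (gauss s 0)); apply: cvgM; first exact: powR_cvg0.
    by apply: cvg_at_right_filter; exact: continuous_gauss.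
  - have := cvgy_powR_gauss s (p + 1) 0 s0 (ltW p10).
    by under eq_fun do rewrite subr0.
  - have := @integrableB _ _ _ mu `]0%R, +oo[ _ _ _ (ikp (p + 1)) (ikp2 (2 / s)).
    exact.
rewrite RintegralB//.
rewrite !RintegralZl// subr0 => /eqP; rewrite subr_eq0 => /eqP H.
apply: (mulfI (_ : 2 / s != 0)); first by rewrite mulf_neq0 ?invr_eq0// gt_eqF.
rewrite -H; field.
by rewrite gt_eqF.
Qed.

End powR_gauss.

(** * The Gamma function as a Gaussian moment *)

Section gamma.
Context {R : realType}.
Local Notation mu := (@lebesgue_measure R).
Implicit Types (a s x y z p : R).

Lemma square_substitution_segment s (G : R -> R) x y : 0 < s -> 0 < x -> x < y ->
  (forall z, 0 < z -> {for z, continuous G}) ->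
  (\int[mu]_(z in `[(x ^+ 2 / s)%R, (y ^+ 2 / s)%R]) (G z)%:E =
   \int[mu]_(z in `[x, y]) (G (z ^+ 2 / s) * (2 * z / s))%:E)%E.
Proof.
move=> s0 x0 xy cG; pose F (z : R) := z ^+ 2 / s.
have dF z : is_derive z 1 F (2 * z / s).
  rewrite (_ : F = (fun z : R => s^-1 *: z ^+ 2)); last first.
    by apply/funext => t; rewrite /F /GRing.scale/= mulrC.
  by apply: is_derive_eq; rewrite /GRing.scale/=; ring.
have F'E : F^`()%classic = fun z => 2 * z / s.
  by apply/funext => z; rewrite derive1E; exact: derive_val.
have cF : continuous F.
  move=> z; apply: differentiable_continuous; apply/derivable1_diffP.
  by have [] := dF z.
have cF' : continuous (fun z : R => 2 * z / s).
  by move=> z; apply: cvgMr_tmp; apply: cvgMl_tmp.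
have homoF u v : x <= u -> u < v -> F u < F v.
  move=> xu uv; rewrite ltr_pM2r ?invr_gt0// ltr_pXn2r ?nnegrE//.
    exact/ltW/(lt_le_trans x0).
  exact/ltW/(lt_trans _ uv)/(lt_le_trans x0).
rewrite (@integration_by_substitution_increasing R F G x y)//.
- by rewrite F'E.
- exact: ltW.
- by move=> u v; rewrite !in_itv/= => /andP[xu _] _; exact: homoF.
- by move=> z _; rewrite F'E; exact: cF'.
- by rewrite F'E; apply/cvg_ex; eexists; apply: cvg_at_right_filter; exact: cF'.
- by rewrite F'E; apply/cvg_ex; eexists; apply: cvg_at_left_filter; exact: cF'.
- split.
  + by move=> z _; have [] := dF z.
  + by apply: cvg_at_right_filter; exact: cF.
  + by apply: cvg_at_left_filter; exact: cF.
- have Fx0 : 0 < F x by rewrite divr_gt0// exprn_gt0.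
  apply/continuous_within_itvP; first exact: homoF.
  split.
  + by move=> z; rewrite in_itv/= => /andP[Fxz _]; apply: cG; exact: lt_trans Fxz.
  + by apply: cvg_at_right_filter; exact: cG.
  + by apply: cvg_at_left_filter; apply: cG; rewrite (lt_trans Fx0)// homoF.
Qed.

(** The change of variables is made on segments inside the open half-line, then passed to the limit
    on both sides by monotone convergence. *)
Lemma square_substitution s (G : R -> R) : 0 < s ->
  (forall z, 0 < z -> {for z, continuous G}) ->
  (forall z, 0 < z -> 0 <= G z) ->
  (\int[mu]_(z in `]0%R, +oo[) (G z)%:E =
   \int[mu]_(z in `]0%R, +oo[) (G (z ^+ 2 / s) * (2 * z / s))%:E)%E.
Proof.
move=> s0 cG G0.
have cF z : 0 < z -> {for z, continuous (fun z => G (z ^+ 2 / s) * (2 * z / s))}.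
  move=> z0; apply: continuousM; last by apply: cvgMr_tmp; exact: cvgMl_tmp.
  apply: (@continuous_comp _ _ _ (fun z : R => z ^+ 2 / s) G).
    by apply: cvgMr_tmp; exact: exprn_continuous.
  by apply: cG; rewrite divr_gt0// exprn_gt0.
have mfun (f : R -> R) : (forall z, 0 < z -> {for z, continuous f}) ->
    measurable_fun `]0%R : R, +oo[ f.
  move=> cf; apply: open_continuous_measurable_fun => // z.
  by rewrite inE/= in_itv/= andbT => /cf.
pose x_ n : R := n.+1%:R^-1; pose y_ n : R := n.+2%:R.
have x0 n : 0 < x_ n by rewrite invr_gt0.
have xy n : x_ n < y_ n by exact: invn_lt_natr.
(* Stated for arbitrary end sequences, since it is applied both to the segments [[x_ n, y_ n]] and
   to their images. *)
have cvgE (f : R -> R) (u v : nat -> R) : (forall n, 0 < u n) ->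
    {homo u : n m / (n <= m)%N >-> m <= n} ->
    {homo v : n m / (n <= m)%N >-> n <= m} ->
    `]0, +oo[%classic = \bigcup_n `[u n, v n]%classic :> set R ->
    (forall z, 0 < z -> {for z, continuous f}) -> (forall z, 0 < z -> 0 <= f z) ->
    (\int[mu]_(z in `[u n, v n]) (f z)%:E)%E @[n --> \oo] -->
    (\int[mu]_(z in `]0%R, +oo[) (f z)%:E)%E.
  move=> u0 niu ndv E cf f0.
  have pos n z : [set` `[u n, v n]] z -> 0 < z.
    by rewrite /= in_itv/= => /andP[+ _]; exact: lt_le_trans.
  rewrite E; apply: ge0_nondecreasing_set_cvg_integral => //.
  - by move=> n m nm; rewrite subsetEset; exact: nondecreasing_segments nm.
  - move=> n; apply/measurable_EFinP; apply: measurable_funS (mfun _ cf) => //.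
    by move=> z /pos z0; rewrite /= in_itv/= z0.
  - by move=> n z /pos z0; rewrite lee_fin f0.
have ndy : {homo y_ : n m / (n <= m)%N >-> n <= m}.
  by move=> n m nm; rewrite ler_nat.
have H1 := cvgE _ x_ y_ x0 nonincreasing_invn ndy itv0y_segments cF.
have H2 := cvgE G (fun n => x_ n ^+ 2 / s) (fun n => y_ n ^+ 2 / s).
have {}H2 : (\int[mu]_(z in `[x_ n, y_ n]) (G (z ^+ 2 / s) * (2 * z / s))%:E)%E
   @[n --> \oo] --> (\int[mu]_(z in `]0%R, +oo[) (G z)%:E)%E.
  under eq_fun do rewrite -square_substitution_segment//.
  apply: H2 => //.
  - by move=> n; rewrite divr_gt0// exprn_gt0.
  - move=> n m nm; rewrite ler_pM2r ?invr_gt0// ler_pXn2r ?nnegrE ?(ltW (x0 _))//.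
    exact: nonincreasing_invn.
  - by move=> n m nm; rewrite ler_pM2r ?invr_gt0// ler_pXn2r ?nnegrE//; exact: ndy.
  - apply/seteqP; split => z /=.
      rewrite in_itv/= andbT => z0.
      (* The preimage of [z] is [sqrt (s z)]; an index whose segment contains it has an image
         segment containing [z]. *)
      have sz0 : 0 < Num.sqrt (s * z) by rewrite sqrtr_gt0 mulr_gt0.
      have : `]0, +oo[%classic (Num.sqrt (s * z)) by rewrite /= in_itv/= sz0.
      rewrite itv0y_segments => -[n _ /=]; rewrite in_itv/= => /andP[xz zy].
      exists n => //=; rewrite in_itv/= ler_pdivrMr// ler_pdivlMr// (mulrC z).
      have sz : 0 <= s * z by rewrite mulr_ge0// ltW.
      by rewrite -(sqr_sqrtr sz) !ler_pXn2r ?nnegrE ?(ltW sz0) ?(ltW (x0 _))//; apply/andP.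
    move=> [n _] /=; rewrite !in_itv/= andbT => /andP[+ _]; apply: lt_le_trans.
    by rewrite divr_gt0// exprn_gt0.
apply: (cvg_unique _ H2 (H1 _)) => // z z0.
by rewrite mulr_ge0 ?G0 ?divr_gt0 ?exprn_gt0// divr_ge0 ?mulr_ge0// ltW.
Qed.

(** Substitute [z^2 / s] for the variable of Euler's integral. The parameter [s] is free: it is
    [4 t] for the Volterra source and 1 for [Gamma (1/2)]. The condition [1 <= 2 a] keeps the
    exponent of the moment nonnegative. *)
Lemma Gamma_gauss s a : 0 < s -> 1 <= 2 * a ->
  Gamma a = 2 / s `^ a * \int[mu]_(y in `]0, +oo[) (y `^ (2 * a - 1) * gauss s y).
Proof.
move=> s0 a1; rewrite -RintegralZl//; last first.
  by apply: integrable_powR_gauss => //; rewrite subr_ge0.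
rewrite /Gamma /Rintegral (square_substitution s)//.
- congr fine; apply: eq_integral => z; rewrite inE/= in_itv/= andbT => z0.
  congr EFin.
  have -> : (z ^+ 2 / s) `^ (a - 1) = z `^ (2 * a - 1) / z / (s `^ a / s).
    have z2 : (z ^+ 2) `^ (a - 1) = z `^ (2 * a - 1) / z.
      rewrite -powR_mulrn ?ltW// -powRrM -{3}[z]powRr1 ?ltW// -powRB.
        by congr powR; ring.
      by rewrite (gt_eqF z0) implybT.
    rewrite powRM ?exprn_ge0 ?invr_ge0 ?ltW// z2; congr (_ * _).
    rewrite invf_div -powR_inv1 ?ltW// -powRrM -{2}[s]powRr1 ?ltW// -powRB.
      by congr powR; ring.
    by rewrite (gt_eqF s0) implybT.
  rewrite /gauss mulNr; field.
  by rewrite !gt_eqF// powR_gt0.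
- move=> z z0; apply: continuousM.
    apply: differentiable_continuous; apply/derivable1_diffP.
    by have [] := is_derive1_powR (a - 1) z0.
  apply: (@continuous_comp _ _ _ (@GRing.opp R) expR); first exact: opp_continuous.
  exact: continuous_expR.
- by move=> z _; rewrite mulr_ge0 ?powR_ge0 ?expR_ge0.
Qed.

End gamma.

(** * Heat transform of powers *)

Section heat.
Context {R : realType}.
Local Notation mu := (@lebesgue_measure R).
Implicit Types (s x y z p t lambda : R).

(** Differentiation under the integral sign at [x = 0], where the derivative of [gauss s (y - x)] in
    [x] is [2 y / s * gauss s y]. *)
Lemma cvg_powR_gauss_derive s p : 0 < s -> 0 <= p ->
  x^-1 * (\int[mu]_(y in `]0, +oo[) (y `^ p * gauss s (y - x)) -
          \int[mu]_(y in `]0, +oo[) (y `^ p * gauss s y)) @[x --> 0^'] -->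
  2 / s * \int[mu]_(y in `]0, +oo[) (y `^ (p + 1) * gauss s y).
Proof.
move=> s0 p0; have p10 : 0 <= p + 1 by rewrite addr_ge0.
pose f x y := y `^ p * gauss s (y - x).
have f0 : f 0 = fun y => y `^ p * gauss s y.
  by apply/funext => y; rewrite /f subr0.
have df x y : is_derive x 1 (f ^~ y)
    (y `^ p * (- (2 * (x - y) / s) * gauss s (y - x))).
  rewrite (_ : f ^~ y = (fun x => y `^ p *: gauss s (x - y))).
    rewrite gaussB; have dg := is_derive_gaussBl s y x.
    exact: is_deriveZ.
  by apply/funext => z; rewrite /f gaussB.
(* For [|x| < 1], [|2 (x - y) / s| <= 2 (1 + y) / s], and completing the square gives [gauss s (y -
   x) <= exp (1 / s) * gauss (2 s) y]; [G] is the product of these bounds with [y^p]. *)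
pose C := 2 / s * expR s^-1.
pose G y := C * (y `^ p * gauss (2 * s) y) + C * (y `^ (p + 1) * gauss (2 * s) y).
have C0 : 0 <= C by rewrite mulr_ge0 ?expR_ge0// divr_ge0// ltW.
have s20 : 0 < 2 * s by rewrite mulr_gt0.
have powRS y : 0 < y -> y `^ (p + 1) = y `^ p * y.
  by move=> y0; rewrite -[X in _ * X]powRr1 ?ltW// -powRD// (gt_eqF y0) implybT.
have I01 : `](-1)%R : R, 1%R[%classic 0 by rewrite /= in_itv/= ltrN10 ltr01.
have G0 y : 0 <= G y.
  by rewrite addr_ge0// mulr_ge0// mulr_ge0 ?powR_ge0 ?gauss_ge0.
have iG : mu.-integrable `]0%R, +oo[ (EFin \o G).
  have iC q (q0 : 0 <= q) := integrable_scale _ _ _ mu _ C _ (measurable_itv _)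
    (integrable_powR_gauss (2 * s) q s20 q0).
  exact: (@integrableD _ _ _ mu _ (measurable_itv _) _ _ (iC p p0) (iC (p + 1) p10)).
have Gub x y : `](-1)%R : R, 1%R[%classic x -> `]0%R : R, +oo[%classic y ->
    `|partial1of2 f x y| <= G y.
  rewrite /= !in_itv/= andbT => /andP[x1 x2] y0.
  rewrite partial1of2E derive_val /G powRS//.
  have -> : C * (y `^ p * gauss (2 * s) y) + C * (y `^ p * y * gauss (2 * s) y) =
      y `^ p * ((2 * (1 + y) / s) * (expR s^-1 * gauss (2 * s) y)).
    by rewrite /C; ring.
  rewrite normrM ger0_norm ?powR_ge0// ler_wpM2l ?powR_ge0//.
  rewrite normrM [X in _ * X]ger0_norm ?gauss_ge0// ler_pM ?gauss_ge0//.
    rewrite normrN normrM [X in _ * X]ger0_norm ?invr_ge0 ?(ltW s0)//.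
    rewrite ler_pM2r ?invr_gt0// normrM ger0_norm// ler_pM2l//.
    by rewrite ler_norml; apply/andP; split; lra.
  rewrite /gauss -expRD ler_expR -subr_ge0.
  have -> : s^-1 + - y ^+ 2 / (2 * s) - - (y - x) ^+ 2 / s =
      ((y - 2 * x) ^+ 2 + 2 * (1 - x ^+ 2)) / (2 * s).
    by field; rewrite gt_eqF.
  rewrite divr_ge0 ?(ltW s20)// addr_ge0 ?sqr_ge0// mulr_ge0//.
  nra.
have := @cvg_differentiation_under_integral R _ _ mu f `]0%R, +oo[%classic
  (measurable_itv _) 0 (-1) 1 I01
  (fun x _ => integrable_powR_gaussB s p x s0 p0)
  (fun x y _ _ => @ex_derive _ _ _ _ _ _ _ (df x y)) G G0 iG Gub.
have -> : \int[mu]_(y in `]0%R, +oo[) partial1of2 f 0 y =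
    2 / s * \int[mu]_(y in `]0, +oo[) (y `^ (p + 1) * gauss s y).
  rewrite -RintegralZl//; last exact: integrable_powR_gauss.
  apply: eq_Rintegral => y; rewrite inE/= in_itv/= andbT => y0.
  by rewrite partial1of2E derive_val powRS// subr0; ring.
rewrite f0; apply: cvg_trans; apply: near_eq_cvg; near=> x.
by rewrite addr0.
Unshelve. all: end_near. Qed.

Lemma integrable_powR_gauss_diff s p x : 0 < s -> 0 <= p ->
  mu.-integrable `]0, +oo[
    (EFin \o (fun y => y `^ p * (gauss s (y - x) - gauss s (y + x)))).
Proof.
move=> s0 p0.
have := @integrableB _ _ _ mu _ (measurable_itv _) _ _
  (integrable_powR_gaussB s p x s0 p0) (integrable_powR_gaussB s p (- x) s0 p0).
by apply: eq_integrable => // y _; rewrite /= -EFinB -mulrBr opprK.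
Qed.

(** With [D] the difference quotient of the previous limit, the expression is [D x + D (- x)]: the
    two-sided limit is used once from each side, whence the doubled constant. *)
Lemma cvg_powR_gauss_diff s p : 0 < s -> 0 <= p ->
  x^-1 * \int[mu]_(y in `]0, +oo[)
            (y `^ p * (gauss s (y - x) - gauss s (y + x))) @[x --> 0^'+] -->
  4 / s * \int[mu]_(y in `]0, +oo[) (y `^ (p + 1) * gauss s y).
Proof.
move=> s0 p0; set L := \int[mu]_(y in _) (_ `^ (p + 1) * _).
pose J x := \int[mu]_(y in `]0, +oo[) (y `^ p * gauss s (y - x)).
pose J0 := \int[mu]_(y in `]0, +oo[) (y `^ p * gauss s y).
pose D x := x^-1 * (J x - J0).
have DL : D x @[x --> 0^'] --> 2 / s * L by exact: cvg_powR_gauss_derive.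
have -> : 4 / s * L = 2 / s * L + 2 / s * L by rewrite -mulrDl -mulrDl -natrD.
rewrite (_ : (fun _ => _) = fun x => D x + D (- x)).
  apply: cvgD; first exact: cvg_dnbhs_at_right DL.
  by have /cvg_at_leftNP := cvg_dnbhs_at_left DL; rewrite oppr0.
apply/funext => x; rewrite /D invrN mulNr -mulrN -mulrDr opprB addrA subrK.
congr (_ * _); rewrite -RintegralB//; try exact: integrable_powR_gaussB.
by apply: eq_Rintegral => y _; rewrite opprK mulrBr.
Qed.

(** Writing [y = (y - x) + x] in one term and [y = (y + x) - x] in the other splits the integrand
    into an exact derivative and [x] times the sum of the two Gaussians, whose integral is known. *)
Lemma Rintegral_gauss_diff s x : 0 < s ->
  \int[mu]_(y in `]0, +oo[) (y * (gauss s (y - x) - gauss s (y + x))) =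
  x * Num.sqrt (pi * s).
Proof.
move=> s0.
have i0 z : mu.-integrable `]0%R, +oo[ (EFin \o (fun y => gauss s (y - z))).
  have := integrable_powR_gaussB s 0 z s0 (lexx _).
  by apply: eq_integrable => // y _ /=; rewrite powRr0 mul1r.
have i1 z : mu.-integrable `]0%R, +oo[ (EFin \o (fun y => y * gauss s (y - z))).
  have := integrable_powR_gaussB s 1 z s0 ler01.
  apply: eq_integrable => // y; rewrite inE/= in_itv/= andbT => y0.
  by rewrite powRr1// ltW.
pose f y := y * (gauss s (y - x) - gauss s (y - - x)).
pose g y := x * (gauss s (y - x) + gauss s (y - - x)).
have if_ : mu.-integrable `]0%R, +oo[ (EFin \o f).
  have := @integrableB _ _ _ mu _ (measurable_itv _) _ _ (i1 x) (i1 (- x)).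
  by apply: eq_integrable => // y _; rewrite /f /= -EFinB mulrBr.
have ig : mu.-integrable `]0%R, +oo[ (EFin \o g).
  apply: integrable_scale => //.
  exact: (@integrableD _ _ _ mu _ (measurable_itv _) _ _ (i0 x) (i0 (- x))).
have gE : \int[mu]_(y in `]0, +oo[) g y = x * Num.sqrt (pi * s).
  rewrite RintegralZl//.
    rewrite -(Rintegral_gauss_pair s x s0); congr (_ * _).
    by apply: eq_Rintegral => y _; rewrite opprK.
  exact: (@integrableD _ _ _ mu _ (measurable_itv _) _ _ (i0 x) (i0 (- x))).
have dK z y := is_derive_gaussBl s z y.
(* This primitive of [f - g] vanishes at 0, because [gauss] is even, and at infinity. *)
pose F y := - (s / 2) *: (gauss s (y - x) - gauss s (y - - x)).
have dF y : is_derive y 1 F (f y - g y).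
  have -> : f y - g y = - (s / 2) *: (- (2 * (y - x) / s) * gauss s (y - x) -
                                   - (2 * (y - - x) / s) * gauss s (y - - x)).
    by rewrite /f /g /GRing.scale/=; field; rewrite gt_eqF.
  exact: is_deriveZ.
have cF : continuous F.
  move=> y; apply: differentiable_continuous; apply/derivable1_diffP.
  by have [] := dF y.
have : \int[mu]_(y in `]0, +oo[) (f y - g y) = 0 - F 0.
  apply: (@improper_FTC2_0y _ _ F) => //.
  - move=> y _; have ck z := continuous_gaussBl s z y.
    apply: cvgB; apply: cvgM; [exact: cvg_id| |exact: cvg_cst|].
      exact: cvgB (ck x) (ck (- x)).
    exact: cvgD (ck x) (ck (- x)).
  - by apply: cvg_at_right_filter; exact: cF.
  - rewrite -(scaler0 _ (- (s / 2))); apply: cvgZl_tmp.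
    have c0 z : gauss s (y - z) @[y --> +oo] --> 0.
      have := cvgy_powR_gauss s 0 z s0 (lexx _).
      by under eq_fun do rewrite powRr0 mul1r.
    by rewrite -[X in _ --> X](subr0 0); apply: cvgB.
  - exact: (@integrableB _ _ _ mu _ (measurable_itv _) _ _ if_ ig).
rewrite RintegralB// gE /F !sub0r opprK gaussN subrr scaler0 oppr0.
move=> /eqP; rewrite subr_eq0 => /eqP <-.
by apply: eq_Rintegral => y _; rewrite /f opprK.
Qed.

End heat.

(** * The Volterra equation with constant kernel *)

Section volterra.
Context {R : realType}.
Local Notation mu := (@lebesgue_measure R).
Implicit Types (a b c x y t : R) (V : R -> R).

Lemma integrable_itv_oo_cc V t : mu.-integrable `]0, t[ (EFin \o V) ->
  mu.-integrable `[0, t] (EFin \o V).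
Proof.
move=> /integrableP[mV iV]; apply/integrableP; split.
  exact/emeasurable_fun_itv_obnd_cbndP/emeasurable_fun_itv_bndo_bndcP.
by rewrite integral_itv_bndoo//; exact: measurableT_comp.
Qed.

(** Regularity is bootstrapped from the equation: [V] is integrable, so its integral [W] is
    continuous, so [V] is continuous for positive times, so [W] has derivative [V]. The integrating
    factor [exp (b x)] then removes [V] from the derivative. *)
Lemma volterra_cst_kernel a b c V : 0 <= a ->
  (forall t, 0 < t -> mu.-integrable `]0, t[ (EFin \o V) /\
     V t = c * t `^ a - b * \int[mu]_(y in `]0, t[) V y) ->
  forall t, 0 < t -> V t = expR (- (b * t)) *
    (if a == 0 then c
     else c * a * \int[mu]_(y in `]0, t[) (y `^ (a - 1) * expR (b * y))).
Proof.
move=> a0 HV t t0; pose W x := parameterized_integral mu 0 x V.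
have iV u : 0 < u -> mu.-integrable `[0, u] (EFin \o V).
  by move=> /HV[iVu _]; exact: integrable_itv_oo_cc.
have VE x : 0 < x -> V x = c * x `^ a - b * W x.
  move=> x0; have [iVx ->] := HV x x0; congr (_ - _ * _).
  rewrite /W /parameterized_integral Rintegral_itv_bndo_bndc//.
  rewrite Rintegral_itv_obnd_cbnd//; apply: integrableS (iV x x0) => //.
  by apply: subset_itv; rewrite bnd_simp.
have W0 : W x @[x --> 0^'+] --> 0.
  have /cvg_at_right_filter := parameterized_integral_cvg_left ltr01 (iV 1 ltr01).
  exact.
have cpow x : 0 < x -> {for x, continuous (fun y => y `^ a)}.
  move=> x0; apply: differentiable_continuous; apply/derivable1_diffP.
  by have [] := is_derive1_powR a x0.
have cW x : 0 < x -> {for x, continuous W}.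
  move=> x0; have x10 : 0 < x + 1 by rewrite addr_gt0.
  have := parameterized_integral_continuous (ltW x10) (iV _ x10).
  move/(continuous_within_itvP _ x10) => -[+ _ _]; apply.
  by rewrite in_itv/= x0 ltrDl ltr01.
have cV x : 0 < x -> {for x, continuous V}.
  move=> x0; rewrite /prop_for /continuous_at (VE x x0).
  apply: (@cvg_trans _ ((fun y => c * y `^ a - b * W y) @ x)).
    apply: near_eq_cvg; near=> y; rewrite VE//.
    by near: y; exact: lt_nbhsr.
  exact: cvgB (cvgMl_tmp (cpow _ x0)) (cvgMl_tmp (cW _ x0)).
have dW x : 0 < x -> is_derive x 1 W (V x).
  move=> x0; have x1 : x < x + 1 by rewrite ltrDl.
  have [|dWx WE] := continuous_FTC1_closed x1 (iV _ _) x0 (cV _ x0).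
    exact: lt_trans x1.
  by apply: DeriveDef => //; rewrite -derive1E.
(* For positive [x] this is [exp (b x) V x]; expressing it through [W] makes it differentiable by
   the usual rules. *)
pose psi x := expR (b * x) * (c * x `^ a - b * W x).
have dexp x : is_derive x 1 (fun x => expR (b * x)) (b * expR (b * x)).
  have d1 : is_derive x 1 (fun x => b * x) b.
    by apply: is_derive_eq; rewrite /GRing.scale/= mulr1.
  by rewrite mulrC; exact: is_derive1_comp (is_derive_expR _) d1.
have cexp x : {for x, continuous (fun x => expR (b * x))}.
  apply: differentiable_continuous; apply/derivable1_diffP.
  by have [] := dexp x.
have dpsi x : 0 < x -> is_derive x 1 psi (c * a * (x `^ (a - 1) * expR (b * x))).
  move=> x0; have := dW x x0; have := is_derive1_powR a x0 => dp dWx.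
  have de := dexp x.
  have df : is_derive x 1 (fun x => c * x `^ a - b * W x)
      (c *: (a * x `^ (a - 1)) - b *: V x).
    exact: is_deriveB.
  apply: is_derive_eq; rewrite /GRing.scale/= (VE x x0); ring.
have e1 : expR (b * x) @[x --> 0^'+] --> (1 : R).
  by have := cvg_at_right_filter (cexp 0); rewrite mulr0 expR0.
(* The power [x^a] tends to 0 at [0+], except for [a = 0], where it is identically 1. *)
have psi0 : psi x @[x --> 0^'+] --> (if a == 0 then c else 0).
  have bW0 : b * W x @[x --> 0^'+] --> 0.
    by rewrite -[X in _ --> X](mulr0 b); exact: cvgMl_tmp.
  have cx0 : c * x `^ a @[x --> 0^'+] --> (if a == 0 then c else 0).
    case: eqVneq => [->|an0].
      by under eq_fun do rewrite powRr0 mulr1; exact: cvg_cst.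
    rewrite -[X in _ --> X](mulr0 c); apply: cvgMl_tmp; apply: powR_cvg0.
    by rewrite lt0r an0.
  have := cvgM e1 (cvgB cx0 bW0); rewrite subr0 mul1r. exact.
have psit : V t = expR (- (b * t)) * psi t.
  by rewrite /psi mulrA -expRD addNr expR0 mul1r VE.
rewrite psit; congr (_ * _).
(* When [c a = 0], [psi] is constant. Otherwise dividing by [c a] leaves a nonnegative derivative
   whatever the sign of [c], so the nonnegative form of the fundamental theorem applies. *)
have [ca0|ca0] := eqVneq (c * a) 0.
  have dpsi0 x : 0 < x -> is_derive x 1 psi 0.
    by move=> x0; rewrite -(mul0r (x `^ (a - 1) * expR (b * x))) -ca0; exact: dpsi.
  have := @ge0_improper_FTC2_0c R (fun=> 0) psi _ t t0
    (fun x _ => @cst_continuous _ _ 0 x) (fun x _ => lexx 0) dpsi0 psi0.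
  rewrite (_ : \int[mu]_(_ in _) 0 = 0); last by rewrite /Rintegral integral0.
  by move/eqP; rewrite eq_sym subr_eq0 => /eqP ->; rewrite ca0 mul0r.
have an0 : a != 0 by apply: contraNneq ca0 => ->; rewrite mulr0.
rewrite (negbTE an0) in psi0 *.
pose f y := y `^ (a - 1) * expR (b * y).
have df x : 0 < x -> is_derive x 1 (fun y => (c * a)^-1 *: psi y) (f x).
  move=> x0; rewrite (_ : f x = (c * a)^-1 *: (c * a * f x)).
    by apply: is_deriveZ; exact: dpsi.
  by rewrite /GRing.scale/= mulKf.
rewrite (@ge0_improper_FTC2_0c R f (fun y => (c * a)^-1 *: psi y) 0 t)//.
- by rewrite subr0 /GRing.scale/= mulVKf.
- move=> x x0; apply: continuousM; last exact: cexp.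
  apply: differentiable_continuous; apply/derivable1_diffP.
  by have [] := is_derive1_powR (a - 1) x0.
- by move=> x _; rewrite mulr_ge0 ?powR_ge0 ?expR_ge0.
- by rewrite -[X in _ --> X](scaler0 _ (c * a)^-1); exact: cvgZl_tmp.
Unshelve. all: end_near. Qed.

End volterra.

(** * Power initial data and linear source *)

Section power_data.
Context {R : realType}.
Local Notation mu := (@lebesgue_measure R).
Variables (nu lambda eta m : R) (m_ge1 : 1 <= m) (h Phi : R -> R).
Hypothesis hh : forall x, 0 < x -> h x = eta * x `^ m.
Hypothesis hPhi : forall x, 0 < x -> Phi x = lambda * x.
Implicit Types x t tau : R.

Let m0 : 0 <= m. Proof. exact: le_trans m_ge1. Qed.
Let m10 : 0 <= m - 1. Proof. by rewrite subr_ge0. Qed.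

Lemma heat_kernelE x t xi tau : heat_kernel x t xi tau =
  (2 * Num.sqrt (pi * (t - tau)))^-1 * gauss (4 * (t - tau)) (xi - x).
Proof. by rewrite gaussB. Qed.

Lemma greenE x t xi tau : green x t xi tau =
  (2 * Num.sqrt (pi * (t - tau)))^-1 *
  (gauss (4 * (t - tau)) (xi - x) - gauss (4 * (t - tau)) (xi + x)).
Proof. by rewrite /green !heat_kernelE -mulrBr opprK. Qed.

Lemma sqrt_pi4 t : Num.sqrt (pi * (4 * t)) = 2 * Num.sqrt (pi * t) :> R.
Proof.
rewrite mulrCA sqrtrM// (_ : 4 = 2 ^+ 2); last by rewrite -natrX.
by rewrite sqrtr_sqr ger0_norm.
Qed.

Lemma sqrt_pi_gt0 t : 0 < t -> 0 < Num.sqrt (pi * t) :> R.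
Proof. by move=> t0; rewrite sqrtr_gt0 mulr_gt0 ?pi_gt0. Qed.

(** A linear profile vanishing at 0 is stationary for the heat equation with zero boundary value, so
    the Green function preserves it. *)
Lemma Rintegral_green_linear x t tau : tau < t ->
  \int[mu]_(xi in `]0, +oo[) (green x t xi tau * Phi xi) = lambda * x.
Proof.
move=> tau_t; have s0 : 0 < 4 * (t - tau) by rewrite mulr_gt0 ?subr_gt0.
set k := (2 * Num.sqrt (pi * (t - tau)))^-1.
transitivity (\int[mu]_(y in `]0, +oo[) (k * lambda * (y *
    (gauss (4 * (t - tau)) (y - x) - gauss (4 * (t - tau)) (y + x))))).
  apply: eq_Rintegral => y; rewrite inE/= in_itv/= andbT => y0.
  by rewrite greenE hPhi// -/k; ring.
rewrite RintegralZl//.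
  rewrite Rintegral_gauss_diff// sqrt_pi4 /k; field.
  by rewrite gt_eqF// sqrt_pi_gt0// subr_gt0.
have := integrable_powR_gauss_diff _ 1 x s0 ler01.
apply: eq_integrable => // y; rewrite inE/= in_itv/= andbT => y0.
by rewrite powRr1// ltW.
Qed.

(** The second Gaussian moment equals [2 sqrt pi t^(3/2)], which cancels the prefactor. *)
Lemma volterra_kernel_linear t : 0 < t -> volterra_kernel Phi t = lambda.
Proof.
move=> t0; have s0 : 0 < 4 * t by rewrite mulr_gt0.
rewrite /volterra_kernel.
have -> : \int[mu]_(xi in `]0, +oo[) (xi * expR (- xi ^+ 2 / (4 * t)) * Phi xi) =
    \int[mu]_(y in `]0, +oo[) (lambda * (y `^ (0 + 2) * gauss (4 * t) y)).
  apply: eq_Rintegral => y; rewrite inE/= in_itv/= andbT => y0.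
  by rewrite hPhi// add0r powR_mulrn ?ltW// /gauss; ring.
rewrite RintegralZl//; last by apply: integrable_powR_gauss => //; rewrite add0r.
rewrite Rintegral_powR_gauss_rec//.
under eq_Rintegral do rewrite powRr0 mul1r.
rewrite Rintegral_gauss// sqrt_pi4.
have -> : t `^ (3 / 2) = t * Num.sqrt t.
  rewrite -powR12_sqrt ?ltW// -{2}[t]powRr1 ?ltW// -powRD; first by congr powR; lra.
  by rewrite (gt_eqF t0) implybT.
rewrite sqrtrM ?pi_ge0//; field.
by rewrite !gt_eqF ?sqrtr_gt0 ?pi_gt0.
Qed.

Lemma derive1_power_data x : 0 < x -> derive1 h x = eta * m * x `^ (m - 1).
Proof.
(* [h] is prescribed on positive reals only, which suffices in a neighbourhood of [x]. *)
move=> x0; rewrite derive1E (@near_eq_derive _ _ _ _ (fun y => eta *: y `^ m)).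
- have dp := is_derive1_powR m x0.
  by rewrite deriveZ ?derive_val//= /GRing.scale/= mulrA.
- by near=> y; rewrite hh//; near: y; exact: lt_nbhsr.
Unshelve. all: end_near. Qed.

Lemma volterra_source_power t : 0 < t -> volterra_source h t =
  eta * m / Num.sqrt (pi * t) *
  \int[mu]_(y in `]0, +oo[) (y `^ (m - 1) * gauss (4 * t) y).
Proof.
move=> t0; rewrite mulrAC mulrC -RintegralZl//; last first.
  by apply: integrable_powR_gauss => //; rewrite mulr_gt0.
congr (_ * _).
apply: eq_Rintegral => y; rewrite inE/= in_itv/= andbT => y0.
by rewrite derive1_power_data// /gauss; ring.
Qed.

(** Take [a = m / 2] and [s = 4 t] in [Gamma_gauss]. The factor [(4 t)^(m/2)] splits as
    [2^m t^((m-1)/2) sqrt t], and [sqrt t] cancels against [sqrt (pi t)]. *)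
Lemma volterra_source_Gamma t : 0 < t -> volterra_source h t =
  2 `^ (m - 1) * m * eta / Num.sqrt pi * Gamma (m / 2) * t `^ ((m - 1) / 2).
Proof.
move=> t0; have s0 : 0 < 4 * t by rewrite mulr_gt0.
rewrite volterra_source_power// (@Gamma_gauss R (4 * t))//; last by rewrite mulrC divfK.
have mE : 2 * (m / 2) = m :> R by rewrite mulrC divfK.
rewrite mE.
set M := \int[mu]_(_ in _) _.
have -> : (4 * t) `^ (m / 2) = 2 `^ m * (t `^ ((m - 1) / 2) * Num.sqrt t).
  rewrite powRM ?ltW// (_ : 4 = 2 `^ 2); last by rewrite powR_mulrn// -natrX.
  rewrite -powRrM mE; congr (_ * _).
  rewrite -powR12_sqrt ?ltW// -powRD; first by congr powR; lra.
  by rewrite (gt_eqF t0) implybT.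
have -> : 2 `^ m = 2 `^ (m - 1) * 2 :> R.
  rewrite -{3}[2]powRr1// -powRD; first by rewrite subrK.
  by rewrite pnatr_eq0 implybT.
rewrite sqrtrM ?pi_ge0//; field.
by rewrite !gt_eqF ?powR_gt0 ?sqrtr_gt0 ?pi_gt0.
Qed.

(** Differentiating the Green function produces the moment of order [m + 1], while the source, built
    on the derivative of [h], has the one of order [m - 1]; the moment recursion identifies them. *)
Lemma cvg_green_flux t : 0 < t ->
  x^-1 * \int[mu]_(xi in `]0, +oo[) (green x t xi 0 * h xi) @[x --> 0^'+] -->
  volterra_source h t.
Proof.
move=> t0; have s0 : 0 < 4 * t by rewrite mulr_gt0.
set k := (2 * Num.sqrt (pi * t))^-1 * eta.
have -> : volterra_source h t =
    k * (4 / (4 * t) * \int[mu]_(y in `]0, +oo[) (y `^ (m + 1) * gauss (4 * t) y)).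
  rewrite volterra_source_power// (_ : m + 1 = m - 1 + 2); last lra.
  rewrite Rintegral_powR_gauss_rec// /k.
  set M := \int[mu]_(_ in _) _; field.
  by rewrite !gt_eqF// sqrt_pi_gt0.
have H := cvg_powR_gauss_diff (4 * t) m s0 m0.
apply: cvg_trans (cvgMl_tmp H); apply: near_eq_cvg; near=> x.
rewrite /= mulrCA; congr (_ * _); rewrite -RintegralZl//.
  apply: eq_Rintegral => y; rewrite inE/= in_itv/= andbT => y0.
  by rewrite greenE hh// subr0 /k; ring.
exact: integrable_powR_gauss_diff.
Unshelve. all: end_near. Qed.

Variables (V : R -> R) (u : R -> R -> R).
Hypothesis lambda_neq0 : lambda != 0.
Hypothesis u_repr : integral_representation nu h Phi V u.
Hypothesis u0 : forall t, 0 < t -> u 0 t = 0.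
Hypothesis V_volterra : solves_volterra nu h Phi V.

Lemma volterra_linear t : 0 < t -> mu.-integrable `]0, t[ (EFin \o V) /\
  V t = volterra_source h t - nu * lambda * \int[mu]_(y in `]0, t[) V y.
Proof.
move=> t0; have [iRV VE] := V_volterra t t0.
have RE : {in `]0, t[%classic, (fun y => volterra_kernel Phi (t - y) * V y) =1
    (fun y => lambda * V y)}.
  move=> y; rewrite inE/= in_itv/= => /andP[_ yt].
  by rewrite volterra_kernel_linear// subr_gt0.
(* Integrability is assumed for the kernel times [V], that is for [lambda V]; dividing by [lambda]
   gives it for [V]. *)
have iV : mu.-integrable `]0, t[ (EFin \o V).
  have := integrable_scale _ _ _ mu _ lambda^-1 _ (measurable_itv _) iRV.
  by apply: eq_integrable => // y /RE /= ->; rewrite mulKf.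
split => //; rewrite VE; congr (_ - _); rewrite -mulrA; congr (_ * _).
rewrite -RintegralZl//.
exact: eq_Rintegral.
Qed.

(** The source contributes exactly [nu lambda x] times the integral of [V], so its quotient by [x]
    is constant and the limit is the right-hand side of the Volterra equation. *)
Lemma cvg_flux_quotient t : 0 < t -> flux_quotient u t x @[x --> 0^'+] --> V t.
Proof.
move=> t0; have [iV ->] := volterra_linear t t0.
apply: cvg_trans (cvgB (cvg_green_flux t t0) (cvg_cst _)).
apply: near_eq_cvg; near=> x.
have x0 : 0 < x by near: x; exact: nbhs_right_gt.
rewrite /flux_quotient u0// subr0 u_repr ?ltW//= mulrBr; congr (_ - _).
have -> : \int[mu]_(tau in `]0, t[)
    ((\int[mu]_(xi in `]0, +oo[) (green x t xi tau * Phi xi)) * V tau) =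
    lambda * x * \int[mu]_(y in `]0, t[) V y.
  rewrite -RintegralZl//; apply: eq_Rintegral => y.
  by rewrite inE/= in_itv/= => /andP[_ yt]; rewrite Rintegral_green_linear.
by field; rewrite gt_eqF.
Unshelve. all: end_near. Qed.

End power_data.

(** This value makes [c] equal to [eta] when [m = 1]. *)
Lemma Gamma_half (R : realType) : Gamma (1 / 2 : R) = Num.sqrt pi.
Proof.
rewrite (@Gamma_gauss R 1)//; last lra.
have -> : 2 * (1 / 2) - 1 = 0 :> R by field.
under eq_Rintegral do rewrite powRr0 mul1r.
by rewrite Rintegral_gauss// powR1 mulr1 divr1 mulrC divfK.
Qed.

Theorem proposition2p2 (R : realType) (nu lambda eta m : R)
    (nu_gt0 : 0 < nu) (lambda_gt0 : 0 < lambda) (eta_neq0 : eta != 0)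
    (m_ge1 : 1 <= m)
    (F : R -> R -> R) (hF : forall V t, 0 < t -> F V t = nu * V)
    (h : R -> R) (hh : forall x, 0 < x -> h x = eta * x `^ m)
    (Phi : R -> R) (hPhi : forall x, 0 < x -> Phi x = lambda * x)
    (u : R -> R -> R) (V : R -> R)
    (u_solution : solves_problemP F h Phi u)
    (u_repr : integral_representation nu h Phi V u)
    (V_volterra : solves_volterra nu h Phi V)
    (t : R) (t_gt0 : 0 < t) :
  let c := 2 `^ (m - 1) * m * eta / Num.sqrt pi * Gamma (m / 2) in
  cvg (flux_quotient u t x @[x --> 0^'+]) /\
  boundary_flux u t =
    (if m == 1 then eta * expR (- (nu * lambda * t))
     else c * (m - 1) / 2 * expR (- (nu * lambda * t))
          * \int[@lebesgue_measure R]_(tau in `]0, t[)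
              (tau `^ ((m - 3) / 2) * expR (nu * lambda * tau))).
Proof.
move=> c; set mu := lebesgue_measure.
have lambda_neq0 : lambda != 0 by rewrite gt_eqF.
have fluxV : flux_quotient u t x @[x --> 0^'+] --> V t.
  exact: (@cvg_flux_quotient R nu lambda eta m m_ge1 h Phi hh hPhi V u
    lambda_neq0 u_repr (problemP_boundary u_solution) V_volterra).
(* Convergence makes the [lim] in [boundary_flux] a genuine limit rather than a default value. *)
split; first by apply/cvg_ex; exists (V t).
rewrite /boundary_flux (cvg_lim _ fluxV)//.
have a0 : 0 <= (m - 1) / 2 by rewrite divr_ge0// subr_ge0.
have VE x : 0 < x -> mu.-integrable `]0, x[ (EFin \o V) /\
    V x = c * x `^ ((m - 1) / 2) - nu * lambda * \int[mu]_(y in `]0, x[) V y.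
  move=> x0; have [iV ->] :=
    @volterra_linear R nu lambda h Phi hPhi V lambda_neq0 V_volterra x x0.
  by split=> //; rewrite (volterra_source_Gamma eta m m_ge1 h hh).
rewrite (volterra_cst_kernel _ (nu * lambda) c V a0 VE)//.
(* The exponent [a = (m - 1) / 2] of the source vanishes exactly in the linear case. *)
have -> : ((m - 1) / 2 == 0) = (m == 1).
  by rewrite mulf_eq0 subr_eq0 invr_eq0 pnatr_eq0 orbF.
case: eqVneq => [m1|_].
  rewrite mulrC; congr (_ * _).
  rewrite /c m1 subrr powRr0 mul1r mul1r Gamma_half divfK//.
  by rewrite gt_eqF// sqrtr_gt0 pi_gt0.
have -> : (m - 1) / 2 - 1 = (m - 3) / 2 by field.
ring.
Qed.
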